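(* There exists an infinite family of strings, containing strings of arbitrarily large length $n$, and a constant $C>0$ such that every string $w$ of length $n\ge 2$ in the family satisfies $\delta(w) \ge C\,\ell(w)\log n$; that is, $\delta = \Omega(\ell\log n)$ on this family.
   Context: For a string $w[1,n]$, let $S_w(k)$ be the number of distinct substrings of length $k$ of $w$, and $\delta(w) = \max\{S_w(k)/k : 1\le k\le n\}$. L-system: a tuple $L=(V,R,S,\tau,d,n)$ where $V$ is a finite set of variables, $R: V\to V^+$ assigns to each variable a nonempty string (extended homomorphically to strings), $S\in V^*$ is the axiom, $\tau: V\to V$ is a coding (letter-to-letter map, extended homomorphically), $d\in\mathbb{N}$ and $n\in\mathbb{N}$. Its levels are $L_0=S$ and $L_{i+1}=R(L_i)$; it generates the string $w[1,n]=\tau(L_d[1,n])$. Its size is $|S|+\sum_{A\in V}|R(A)|$. $\ell(w)$ is the size of the smallest L-system generating $w$. *)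

(* Defs.v *)
From HB Require Import structures.
From mathcomp Require Import all_boot all_order all_algebra.
From mathcomp Require Import finmap.
From mathcomp Require Import all_classical all_reals.
From mathcomp Require Import exp.

Set Implicit Arguments.
Unset Strict Implicit.
Unset Printing Implicit Defensive.

Import Order.TTheory GRing.Theory Num.Theory.

Local Open Scope nat_scope.

(* For [k > size w] the index list is empty, so no truncated factor is listed. *)
Definition substrings (w : seq nat) (k : nat) : seq (seq nat) :=
  undup [seq take k (drop i w) | i <- iota 0 ((size w).+1 - k)].

Definition num_substrings (w : seq nat) (k : nat) : nat := size (substrings w k).

(* The default value 0 is harmless: all the quotients are nonnegative. *)
Definition delta (R : realType) (w : seq nat) : R :=
  \big[Num.max/0%R]_(1 <= k < (size w).+1)
    ((num_substrings w k)%:R / k%:R)%R.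

(* Strings are over the countably infinite alphabet [nat], so that fresh
   auxiliary variables are always available to an L-system. *)
Record Lsystem := LSystem {
  vars : {fset nat};
  rule : vars -> seq vars;
  start : seq vars;
  coding : vars -> vars;
  depth : nat;
  len : nat;
  rule_nonempty : forall A : vars, rule A != [::]
}.

Definition rewrite_string (L : Lsystem) (s : seq (vars L)) : seq (vars L) :=
  flatten [seq rule A | A <- s].

Definition level (L : Lsystem) (i : nat) : seq (vars L) :=
  iter i (@rewrite_string L) (start L).

(* The first conjunct makes the prefix of length [len L] meaningful: [take]
   would otherwise silently return a shorter string. *)
Definition generates (L : Lsystem) (w : seq nat) : Prop :=
  len L <= size (level L (depth L)) /\
  w = [seq val (coding A) | A <- take (len L) (level L (depth L))].

Definition Lsize (L : Lsystem) : nat :=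
  size (start L) + \sum_(A : vars L) size (rule A).

Lemma generating_size_ex (w : seq nat) :
  exists m : nat, `[< exists L : Lsystem, generates L w /\ Lsize L = m >].
Proof.
pose V : {fset nat} := [fset x in w]%fset.
pose s : seq V := pmap insub w.
have sE : map val s = w.
  rewrite pmap_filter; last exact: insubK.
  by apply/all_filterP/allP => x xw; rewrite isSome_insub !inE.
have ne (A : V) : [:: A] != [::] by [].
pose L := @LSystem V (fun A => [:: A]) s id 0 (size s) ne.
exists (Lsize L); apply/asboolP; exists L; split=> //.
by split=> //=; rewrite /level /= take_size sE.
Qed.

Definition ell (w : seq nat) : nat := ex_minn (generating_size_ex w).

(* Main.v *)
(** The morphism [a -> ab], [b -> bc], [c -> c] generates from [a] the strings
    [a b bc bcc ... bc^(d-1)], so the parameter [ell] is bounded on them.  A factor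
    [c^j b c^i b ...] determines [j] and [i], so among the factors of length [4m]
    at least [m^2] are distinct once [d > 3m].  Hence [delta] grows at least
    linearly in [m], whereas the length is only quadratic in [m]. *)
Require Import Defs.
From HB Require Import structures.
From mathcomp Require Import all_boot all_order all_algebra.
From mathcomp Require Import finmap.
From mathcomp Require Import all_classical all_reals.
From mathcomp Require Import exp.
From mathcomp Require Import zify lra.

Set Implicit Arguments.
Unset Strict Implicit.
Unset Printing Implicit Defensive.

Import Order.TTheory GRing.Theory Num.Theory.

Local Open Scope nat_scope.

Definition staircase (T : Type) (b c : T) (d : nat) : seq T :=
  flatten [seq b :: nseq i c | i <- iota 0 d].

Lemma staircaseS (T : Type) (b c : T) (d : nat) :
  staircase b c d.+1 = staircase b c d ++ b :: nseq d c.
Proof.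
by rewrite /staircase -addn1 iotaD map_cat flatten_cat /= add0n cats0.
Qed.

Lemma map_staircase (T U : Type) (f : T -> U) (b c : T) (d : nat) :
  map f (staircase b c d) = staircase (f b) (f c) d.
Proof.
by elim: d => // d IHd; rewrite !staircaseS map_cat IHd /= map_nseq.
Qed.

(** The exact length is [d(d+1)/2]. The lower bound makes the family unbounded; the upper one
    controls the logarithm. *)
Lemma size_staircase (T : Type) (b c : T) (d : nat) :
  d <= size (staircase b c d) <= d ^ 2.
Proof.
elim: d => // d IHd; rewrite staircaseS size_cat /= size_nseq; nia.
Qed.

(** The run just before [b c^i] has length [i - 1 >= j], so it ends in [c^j]. The run of length
    [i + 1] leaves room to pad a window to a prescribed length. *)
Lemma staircase_factor (T : Type) (b c : T) (d i j : nat) :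
  j < i -> i.+1 < d ->
  exists P Q : seq T,
    staircase b c d = P ++ nseq j c ++ b :: nseq i c ++ b :: nseq i.+1 c ++ Q.
Proof.
case: i => // i ji; elim: d => // d IHd; rewrite ltnS leq_eqVlt => /predU1P[<-|/IHd].
  exists (staircase b c i ++ b :: nseq (i - j) c), [::].
  rewrite !staircaseS -!catA /=; congr (_ ++ _ :: _).
  by rewrite cats0 [RHS]catA -nseqD subnK.
move=> [P [Q E]]; exists P, (Q ++ b :: nseq d c).
by rewrite staircaseS E -!catA /= -!catA /= -!catA.
Qed.

(** The first [b] marks the end of the run, so run lengths can be decoded from left to right. *)
Lemma eq_nseq_cat (T : eqType) (b c : T) (i i' : nat) (X X' : seq T) :
  b != c -> nseq i c ++ b :: X = nseq i' c ++ b :: X' -> i = i' /\ X = X'.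
Proof.
move=> bc; elim: i i' => [|i IHi] [|i'] /=.
- by case.
- by case=> E; rewrite E eqxx in bc.
- by case=> E; rewrite E eqxx in bc.
- by case=> /IHi [-> ->].
Qed.

Lemma prefix_substrings (P Y : seq nat) (k : nat) :
  k <= size Y -> take k Y \in substrings (P ++ Y) k.
Proof.
move=> kY; rewrite mem_undup; apply/mapP; exists (size P).
  rewrite mem_iota size_cat; lia.
by rewrite drop_size_cat.
Qed.

Definition staircase_word (m : nat) : seq nat := 0 :: staircase 1 2 (3 * m).+1.

Lemma num_substrings_staircase_word (m : nat) :
  m ^ 2 <= num_substrings (staircase_word m) (4 * m).
Proof.
(* Windows [c^j b c^(2m+i) b c^r] with [i, j < m]. The two prefixed parts have total length at most
   [4m], so the subtraction defining [r] is exact. *)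
pose f (p : 'I_m * 'I_m) : seq nat :=
  nseq p.1 2 ++ 1 :: nseq (2 * m + p.2) 2 ++
  1 :: nseq (4 * m - (p.1 + (2 * m + p.2)).+2) 2.
have f_inj : injective f.
  move=> [j i] [j' i'] /eq_nseq_cat -[] //= jj' /eq_nseq_cat -[] // ii' _.
  by congr pair; apply: val_inj => //=; lia.
have -> : m ^ 2 = size [seq f p | p : 'I_m * 'I_m].
  by rewrite size_map -cardE card_prod card_ord mulnn.
apply: uniq_leq_size; first by rewrite map_inj_uniq // enum_uniq.
move=> _ /mapP[[j i] _ ->]; have := ltn_ord j; have := ltn_ord i => im jm.
have [||P [Q E]] := @staircase_factor nat 1 2 (3 * m).+1 (2 * m + i) j; try lia.
pose r := 4 * m - (j + (2 * m + i)).+2.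
(* The offset [2m] gives [r <= 2m - 2], so the window stops inside the run of length
   [2m + i + 1]. *)
have rE : nseq (2 * m + i).+1 2 = nseq r 2 ++ nseq ((2 * m + i).+1 - r) 2.
  by rewrite -nseqD subnKC // /r; lia.
have {rE}E : staircase_word m =
    (0 :: P) ++ f (j, i) ++ nseq ((2 * m + i).+1 - r) 2 ++ Q.
  by rewrite /staircase_word E rE /f /= -!catA /= -!catA.
have sz : size (f (j, i)) = 4 * m.
  by rewrite !size_cat /= size_cat /= !size_nseq; lia.
rewrite E -{1}(take_size_cat (nseq ((2 * m + i).+1 - r) 2 ++ Q) sz).
by apply: prefix_substrings; rewrite size_cat sz leq_addr.
Qed.

Section StaircaseLsystem.

Let V : {fset nat} := [fset x in [:: 0; 1; 2]]%fset.

Fact in0 : 0 \in V. Proof. by rewrite !inE. Qed.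
Fact in1 : 1 \in V. Proof. by rewrite !inE. Qed.
Fact in2 : 2 \in V. Proof. by rewrite !inE. Qed.

Let a : V := [` in0]%fset.
Let b : V := [` in1]%fset.
Let c : V := [` in2]%fset.

Definition staircase_rule (A : V) : seq V :=
  if A == a then [:: a; b] else if A == b then [:: b; c] else [:: c].

Fact staircase_rule_nonempty (A : V) : staircase_rule A != [::].
Proof. by rewrite /staircase_rule; case: ifP => // _; case: ifP. Qed.

(** Only the depth and the length vary with [m], and neither counts in [Lsize]. *)
Definition staircase_Lsystem (m : nat) : Lsystem :=
  LSystem [:: a] id (3 * m).+1 (size (staircase_word m)) staircase_rule_nonempty.

(** One rewriting turns each block [b c^i] into [b c^(i+1)], while [a] emits a fresh block [b] in
    front of them. *)
Lemma level_staircase_Lsystem (m d : nat) :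
  level (staircase_Lsystem m) d = a :: staircase b c d.
Proof.
elim: d => // d; rewrite /level iterS => ->.
rewrite /rewrite_string /=; congr cons.
elim: d => // d IHd.
rewrite staircaseS map_cat flatten_cat -cat_cons IHd [RHS]staircaseS.
congr cat; rewrite /=; congr [:: _, _ & _].
by elim: d {IHd} => //= d ->.
Qed.

Lemma generates_staircase_word (m : nat) :
  generates (staircase_Lsystem m) (staircase_word m).
Proof.
have E : map val (level (staircase_Lsystem m) (3 * m).+1) = staircase_word m.
  by rewrite level_staircase_Lsystem map_cons map_staircase.
have lenE : len (staircase_Lsystem m) = size (level (staircase_Lsystem m) (3 * m).+1).
  by rewrite -(size_map val) E.
by split; rewrite lenE // take_size; exact/esym.
Qed.

Lemma Lsize_staircase_Lsystem (m : nat) : Lsize (staircase_Lsystem m) <= 7.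
Proof.
rewrite /Lsize /= add1n ltnS.
(* One letter of axiom and three rules of at most two letters: [7 = 1 + 3 * 2]. *)
apply: (@leq_trans (\sum_(A : V) 2)).
  by apply: leq_sum => A _; rewrite /staircase_rule; case: ifP => // _; case: ifP.
by rewrite sum_nat_const -cardfE card_fseq.
Qed.

End StaircaseLsystem.

Lemma ell_le_Lsize (L : Lsystem) (w : seq nat) : generates L w -> ell w <= Lsize L.
Proof.
move=> Lw; rewrite /ell; case: ex_minnP => k _; apply.
by apply/asboolP; exists L.
Qed.

Local Open Scope ring_scope.

Lemma num_substrings_le_delta (R : realType) (w : seq nat) (k : nat) :
  (0 < k)%N -> (num_substrings w k)%:R / k%:R <= delta R w.
Proof.
move=> k0; have [kw|wk] := leqP k (size w).
  by apply: (@le_bigmax_seq _ _ _ _ _ k) => //; rewrite mem_index_iota k0.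
(* Beyond the length of [w] there are no factors, and the default 0 of the maximum bounds the
   quotient. *)
have -> : num_substrings w k = 0%N.
  by rewrite /num_substrings /substrings (_ : (size w).+1 - k = 0)%N //; lia.
by rewrite mul0r /delta; exact: bigmax_ge_id.
Qed.

Lemma ln_size_staircase_word (R : realType) (m : nat) :
  (0 < m)%N -> ln (size (staircase_word m))%:R <= 8 * m%:R :> R.
Proof.
move=> m0; have /andP[_ s] := size_staircase 1%N 2%N (3 * m).+1.
(* The length is at most [1 + (3m+1)^2 <= (1+4m)^2]; then [ln (1 + x) <= x] at [x = 4m] gives
   [8m]. *)
apply: (@le_trans _ _ (ln ((1 + (4 * m)%:R) ^+ 2))).
  rewrite ler_ln ?posrE ?ltr0n ?exprn_gt0 ?ltr_wpDr //.
  by rewrite nat1r -natrX ler_nat; apply: leq_ltn_trans s _; nia.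
have p : -1 < (4 * m)%:R :> R by rewrite (lt_le_trans _ (ler0n _ _)) // ltrN10.
rewrite lnXn ?ltr_wpDr //.
have := le_ln1Dx p; rewrite natrM -mulr_natl; lra.
Qed.

Theorem theorem3 (R : realType) :
  exists F : set (seq nat),
    (forall N : nat, exists w : seq nat, F w /\ (N <= size w)%N) /\
    exists C : R, 0 < C /\
      forall w : seq nat, F w -> (2 <= size w)%N ->
        C * (ell w)%:R * ln (size w)%:R <= delta R w.
Proof.
exists [set staircase_word m | m in [set m | (0 < m)%N]]%classic; split.
  move=> N; exists (staircase_word N.+1); split; first by exists N.+1.
  have /andP[s _] := size_staircase 1%N 2%N (3 * N.+1).+1.
  by apply: leq_trans (leqW s); lia.
(* [224 = 4 * 7 * 8]: [delta] is at least [m^2 / (4m) = m / 4], [ell] is at most 7 and the logarithm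
   at most [8m]. *)
exists (1 / 224); split; first by lra.
move=> _ [m /= m0 <-] _.
have k0 : (0 < 4 * m)%N by lia.
apply: le_trans (num_substrings_le_delta R (staircase_word m) k0).
have m0R : 0 < m%:R :> R by rewrite ltr0n.
rewrite ler_pdivlMr ?ltr0n //.
have cnt : m%:R ^+ 2 <= (num_substrings (staircase_word m) (4 * m))%:R :> R.
  by rewrite -natrX ler_nat num_substrings_staircase_word.
apply: le_trans cnt.
have ell7 : (ell (staircase_word m))%:R <= 7 :> R.
  rewrite (ler_nat R _ 7); apply: leq_trans (Lsize_staircase_Lsystem m).
  exact: ell_le_Lsize (generates_staircase_word m).
have lnm := ln_size_staircase_word R m0.
have ln0 : 0 <= ln (size (staircase_word m))%:R :> R by rewrite ln_ge0 // ler1n.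
(* The product of the two bounds, scaled by [m], leaves an inequality that is linear in the
   monomials. *)
have := ler_wpM2r (ltW m0R) (ler_pM (ler0n R _) ln0 ell7 lnm).
rewrite natrM; lra.
Qed.
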